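(* Let $n\ge 2$ and let $D=(V,A)$ be a strict digraph on $n$ vertices without isolated vertices. Let $\varphi$ be a real function on $\{1,\dots,n-1\}^2$ with $\varphi_{ij}=\varphi_{ji}$, where $\varphi_{ij}=\varphi(i,j)$, and let $I(D)=\frac12\sum_{uv\in A}\varphi(d_u^+,d_v^-)$. Put $L_{ij}=\frac{n-1}{n}\left(\frac1i+\frac1j\right)\varphi_{1,n-1}$ and $S_1=\{(i,j)\mid 1\le i\le j\le n-1\}\setminus\{(1,n-1)\}$. Then: (i) If $\varphi_{ij}>L_{ij}$ for all $(i,j)\in S_1$, then $I(D)\ge \frac{n-1}{2}\varphi_{1,n-1}$, with equality if and only if $n_0=n$ and $p_{ij}=0$ for all $(i,j)\in S_1$, i.e., if and only if $D$ is $\vec K_{1,n-1}$ or $\vec K_{n-1,1}$. (ii) If $\varphi_{ij}<L_{ij}$ for all $(i,j)\in S_1$, then $I(D)\le (n-1)\varphi_{1,n-1}$, with equality if and only if $n_0=0$ and $p_{ij}=0$ for all $(i,j)\in S_1$, i.e., if and only if every vertex of $D$ has positive out-degree and positive in-degree and every arc $uv$ of $D$ satisfies $(d_u^+,d_v^-)\in\{(1,n-1),(n-1,1)\}$.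
   Context: A digraph $D=(V,A)$ is strict: it has no loops and at most one arc from $u$ to $v$ for each ordered pair of distinct vertices. $d_u^+$ and $d_u^-$ denote the out-degree and in-degree of $u$; a vertex is isolated if $d_u^+=d_u^-=0$. For $1\le i,j\le n-1$, $a_{ij}$ is the number of arcs $uv\in A$ with $d_u^+=i$ and $d_v^-=j$ (so $I(D)=\frac12\sum_{1\le i,j\le n-1}a_{ij}\varphi_{ij}$). Set $p_{ij}=a_{ij}+a_{ji}$ for $i\neq j$ and $p_{ii}=a_{ii}$. $n_0$ denotes the number of vertices of out-degree $0$ plus the number of vertices of in-degree $0$. $\vec K_{1,n-1}$ (resp. $\vec K_{n-1,1}$) is the oriented star on $n$ vertices whose center has out-degree $n-1$ (resp. in-degree $n-1$, out-degree $0$), i.e., all arcs go from the center to the leaves (resp. from the leaves to the center).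
   Formalization: The formal statement adds the hypothesis φ_{1,n-1} > 0; for φ_{1,n-1} ≤ 0 the claim fails: the bidirected star violates the bound or the equality case in (i), and the oriented star does so in (ii). *)

(* Defs.v *)
From mathcomp Require Import all_boot all_order all_algebra.

Set Implicit Arguments.
Unset Strict Implicit.
Unset Printing Implicit Defensive.

Import Order.TTheory GRing.Theory Num.Theory.
Local Open Scope ring_scope.

Record strict_digraph (V : finType) := StrictDigraph {
  arc :> rel V;
  arc_irr : irreflexive arc
}.

Section Degrees.
Variables (V : finType) (D : strict_digraph V).
Local Open Scope nat_scope.

Definition outdeg (u : V) : nat := #|[set v | D u v]|.
Definition indeg (v : V) : nat := #|[set u | D u v]|.

Definition isolated (u : V) : bool := (outdeg u == 0) && (indeg u == 0).

Definition a_ (i j : nat) : nat :=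
  #|[set e : V * V | [&& D e.1 e.2, outdeg e.1 == i & indeg e.2 == j]]|.

Definition p_ (i j : nat) : nat := if i == j then a_ i i else a_ i j + a_ j i.

Definition n0 : nat :=
  #|[set u | outdeg u == 0]| + #|[set u | indeg u == 0]|.

(* D is, up to isomorphism, the star with all arcs from the center c to the
   leaves (resp. from the leaves to c); the order is the one of V. *)
Definition is_out_star : Prop :=
  exists c : V, forall u v, D u v = (u == c) && (v != c).
Definition is_in_star : Prop :=
  exists c : V, forall u v, D u v = (u != c) && (v == c).

End Degrees.

Definition S1 (n i j : nat) : bool :=
  [&& (1 <= i)%N, (i <= j)%N, (j <= n.-1)%N & (i, j) != (1%N, n.-1)].

(* phi stands for a function on {1, ..., n-1}^2; its values outside this square
   are never used, since the tail of an arc has out-degree, and its head has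
   in-degree, in that range. *)
Definition index_I (R : realFieldType) (phi : nat -> nat -> R)
    (V : finType) (D : strict_digraph V) : R :=
  2^-1 * \sum_(e : V * V | D e.1 e.2) phi (outdeg D e.1) (indeg D e.2).

Definition L_ (R : realFieldType) (phi : nat -> nat -> R) (n i j : nat) : R :=
  (n.-1)%:R / n%:R * (i%:R^-1 + j%:R^-1) * phi 1%N n.-1.

(* Main.v *)
Require Import Defs.
From mathcomp Require Import all_boot all_order all_algebra.
From mathcomp Require Import ring lra zify.

Set Implicit Arguments.
Unset Strict Implicit.
Unset Printing Implicit Defensive.

Import Order.TTheory GRing.Theory Num.Theory.
Local Open Scope ring_scope.

(** Summing [1/d_u^+ + 1/d_v^-] over the arcs [uv] counts every vertex of
    positive out-degree once and every vertex of positive in-degree once, so it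
    gives [2n - n0], and [0 <= n0 <= n] because no vertex is isolated.  Since
    [L_{1,n-1} = phi_{1,n-1}], the hypotheses compare [phi] with [L] arc by arc,
    with equality exactly on the arcs of degree pair [(1,n-1)] or [(n-1,1)];
    summing yields both bounds together with their equality cases. *)

(** Reversing all arcs swaps out-degree with in-degree, so each fact on in-degrees and in-stars
    comes from its out-version. *)
Definition converse (V : finType) (D : strict_digraph V) : strict_digraph V :=
  @StrictDigraph V (fun u v => D v u) (fun u => arc_irr D u).

Definition extremal_arc (V : finType) (D : strict_digraph V) (u v : V) : bool :=
  ((outdeg D u == 1) && (indeg D v == #|V|.-1))
  || ((outdeg D u == #|V|.-1) && (indeg D v == 1))%N.

(** The quantifier ranges over pairs because [leif_sum] yields its equality case in exactly this
    form. *)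
Definition extremal (V : finType) (D : strict_digraph V) : bool :=
  [forall (e : V * V | D e.1 e.2), extremal_arc D e.1 e.2].

(** * Degree bounds and the extreme values of [n0] *)

Section Degrees.
Variables (V : finType) (D : strict_digraph V).
Local Open Scope nat_scope.

Lemma outdeg_gt0 u v : D u v -> 0 < outdeg D u.
Proof. by move=> Duv; apply/card_gt0P; exists v; rewrite inE. Qed.

Lemma indeg_gt0 u v : D u v -> 0 < indeg D v.
Proof. by move=> Duv; apply/card_gt0P; exists u; rewrite inE. Qed.

Lemma outdeg_le u : outdeg D u <= #|V|.-1.
Proof.
rewrite -(cardsC1 u); apply/subset_leq_card/subsetP => v; rewrite !inE => Duv.
by apply/eqP => vu; rewrite vu arc_irr in Duv.
Qed.

Lemma outdeg_max u v : outdeg D u = #|V|.-1 -> D u v = (v != u).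
Proof.
move=> hu; have /eqP hE : [set w | D u w] == [set~ u].
  rewrite eqEcard cardsC1 -hu leqnn andbT; apply/subsetP => w; rewrite !inE.
  by apply: contraL => /eqP->; rewrite arc_irr.
by move/setP/(_ v): hE; rewrite !inE.
Qed.

Lemma n0_le : (forall u, ~~ isolated D u) -> n0 D <= #|V|.
Proof.
move=> hD; rewrite /n0 -cardsUI (_ : _ :&: _ = set0) ?cards0 ?addn0 ?max_card //.
by apply/setP => u; rewrite !inE; apply: negbTE (hD u).
Qed.

(** Without isolated vertices the sets of sinks and of sources are disjoint, so [n0] is the size of
    their union. *)
Lemma n0_eq_card :
  (forall u, ~~ isolated D u) ->
  n0 D = #|V| <-> forall u, (outdeg D u == 0) || (indeg D u == 0).
Proof.
move=> hD; rewrite /n0 -cardsUI (_ : _ :&: _ = set0); last first.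
  by apply/setP => u; rewrite !inE; apply: negbTE (hD u).
rewrite cards0 addn0 -cardsT; split=> [hc u | h].
  have /eqP hE : [set u | outdeg D u == 0] :|: [set u | indeg D u == 0] == setT.
    by rewrite eqEcard subsetT hc leqnn.
  by move/setP/(_ u): hE; rewrite !inE.
by apply: eq_card => u; rewrite !inE h.
Qed.

Lemma n0_eq0 : n0 D = 0 <-> forall u, 0 < outdeg D u /\ 0 < indeg D u.
Proof.
split=> [/eqP | h].
  rewrite addn_eq0 !cards_eq0 => /andP[/eqP/setP h1 /eqP/setP h2] u.
  by move: (h1 u) (h2 u); rewrite !inE !lt0n => -> ->.
by apply/eqP; rewrite addn_eq0 !cards_eq0; apply/andP; split; apply/eqP/setP => u;
   rewrite !inE; have [h1 h2] := h u; apply/negbTE; rewrite -lt0n.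
Qed.

Lemma extremalP :
  reflect (forall u v, D u v -> extremal_arc D u v) (extremal D).
Proof.
apply: (iffP forall_inP) => [h u v Duv | h [u v]]; last exact: h.
exact: (h (u, v)).
Qed.

End Degrees.

(** * Extremal arcs, vanishing of the [p_], and stars *)

Section Stars.
Variables (V : finType) (D : strict_digraph V).
Local Open Scope nat_scope.

Lemma indeg_le v : indeg D v <= #|V|.-1.
Proof. exact: (outdeg_le (converse D)). Qed.

Lemma indeg_max u v : indeg D v = #|V|.-1 -> D u v = (u != v).
Proof. exact: (@outdeg_max V (converse D)). Qed.

Lemma a_eq0 i j :
  a_ D i j = 0 <-> forall u v, D u v -> ~~ ((outdeg D u == i) && (indeg D v == j)).
Proof.
split=> [/eqP | h].
  rewrite cards_eq0 => /eqP/setP h u v Duv.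
  by move: (h (u, v)); rewrite !inE /= Duv /= => ->.
apply/eqP; rewrite cards_eq0; apply/eqP/setP => -[u v]; rewrite !inE /=.
by apply/negbTE; apply/negP => /andP[Duv]; apply/negP/h.
Qed.

Lemma p_eq0 i j : p_ D i j = 0 <-> a_ D i j = 0 /\ a_ D j i = 0.
Proof.
rewrite /p_; have [<- | _] := eqVneq i j; first by split=> [|[]].
by split=> [/eqP | [-> ->] //]; rewrite addn_eq0 => /andP[/eqP-> /eqP->].
Qed.

(** Both degrees on an arc lie between [1] and [n-1]; once sorted, only the pair [(1, n-1)] escapes
    [S1]. *)
Lemma S1_deg u v : D u v -> ~~ extremal_arc D u v ->
  S1 #|V| (outdeg D u) (indeg D v) || S1 #|V| (indeg D v) (outdeg D u).
Proof.
move=> Duv; rewrite /extremal_arc /S1 !xpair_eqE.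
have := outdeg_gt0 Duv; have := indeg_gt0 Duv.
have := outdeg_le D u; have := indeg_le v; lia.
Qed.

Lemma p_eq0_extremal : (forall i j, S1 #|V| i j -> p_ D i j = 0) <-> extremal D.
Proof.
split=> [h | /extremalP h i j hS].
  apply/extremalP => u v Duv; apply/negPn/negP => /(S1_deg Duv).
  by case/orP => /h /p_eq0 [/a_eq0 h1 /a_eq0 h2];
     [have := h1 _ _ Duv | have := h2 _ _ Duv]; rewrite !eqxx.
(* A pair in [S1] is not [(n-1, 1)] either: being sorted, it would need [n-1 = 1] and be the
   excluded pair. *)
by apply/p_eq0; split; apply/a_eq0 => u v /h; move: hS;
   rewrite /extremal_arc /S1 !xpair_eqE; lia.
Qed.

Lemma out_star_of_center c :
  (forall u, (outdeg D u == 0) || (indeg D u == 0)) ->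
  outdeg D c = #|V|.-1 -> is_out_star D.
Proof.
move=> h hc; exists c => u v; have [-> | uc] /= := eqVneq u c.
  exact: outdeg_max.
(* An arc leaving [u] other than [c] gives [u] positive out-degree, while the arc from [c] gives it
   positive in-degree. *)
apply/negP => Duv; have Dcu : D c u by rewrite outdeg_max.
have := h u; have := outdeg_gt0 Duv; have := indeg_gt0 Dcu; lia.
Qed.

Lemma out_star_extremal : is_out_star D ->
  (forall u, (outdeg D u == 0) || (indeg D u == 0)) /\ extremal D.
Proof.
case=> c hc; split=> [u | ].
  have [-> | uc] := eqVneq u c; apply/orP; [right | left]; rewrite cards_eq0;
  apply/eqP/setP => v; rewrite !inE hc ?eqxx ?andbF ?(negbTE uc) //.
apply/extremalP => u v; rewrite hc => /andP[/eqP-> vc].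
rewrite /extremal_arc; apply/orP; right; apply/andP; split; apply/eqP.
  by rewrite -(cardsC1 c); apply: eq_card => w; rewrite !inE hc eqxx.
by rewrite -(cards1 c); apply: eq_card => w; rewrite !inE hc vc andbT.
Qed.

End Stars.

Lemma extremal_converse (V : finType) (D : strict_digraph V) :
  extremal (converse D) -> extremal D.
Proof.
move=> /extremalP h; apply/extremalP => u v /(h v u).
by case/orP => /andP[h1 h2]; apply/orP; [right | left]; apply/andP.
Qed.

Lemma is_in_star_converse (V : finType) (D : strict_digraph V) :
  is_in_star D <-> is_out_star (converse D).
Proof. by split=> -[c hc]; exists c => u v; rewrite [LHS]hc andbC. Qed.

Lemma extremal_starP (V : finType) (D : strict_digraph V) :
  (1 < #|V|)%N -> (forall u, ~~ isolated D u) ->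
  (n0 D = #|V| /\ extremal D) <-> (is_out_star D \/ is_in_star D).
Proof.
move=> hn hD; rewrite n0_eq_card //; split=> [[h0 /extremalP hE] | [] hS].
- have [u _] : exists u : V, u \in V by apply/card_gt0P; apply: ltnW.
  have [x [y Dxy]] : exists x y, D x y.
    have := hD u; rewrite /isolated negb_and -!lt0n.
    by case/orP => /card_gt0P [v]; rewrite inE => Duv; [exists u, v | exists v, u].
  (* A single arc already reveals the center: the head [y] if its in-degree is [n-1], otherwise the
     tail [x]. *)
  case/orP: (hE _ _ Dxy) => /andP[/eqP h1 /eqP h2].
    right; apply/is_in_star_converse/(@out_star_of_center _ _ y) => // w.
    by rewrite orbC; apply: h0.
  by left; apply: out_star_of_center h1.
- exact: out_star_extremal.
have [h0 hE] := out_star_extremal (iffLR (is_in_star_converse D) hS).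
by split; [move=> u; rewrite orbC; apply: h0 | apply: extremal_converse].
Qed.

(** * Sums over arcs and comparison of [phi] with [L_] *)

Section Sums.
Variables (R : realFieldType) (V : finType).

(** Grouping arcs by tail, a vertex of out-degree [d > 0] contributes [d * (1/d) = 1], and a sink
    contributes an empty sum. *)
Lemma sum_inv_outdeg (D : strict_digraph V) :
  \sum_(e : V * V | D e.1 e.2) (outdeg D e.1)%:R^-1
    = #|V|%:R - #|[set u | outdeg D u == 0%N]|%:R :> R.
Proof.
rewrite -(pair_big_dep xpredT (fun u v => D u v)
            (fun u v => (outdeg D u)%:R^-1 : R)) /=.
rewrite -(cardsC [set u | outdeg D u == 0%N]) natrD addrC addKr.
rewrite -sum1_card natr_sum [RHS]big_mkcond; apply: eq_bigr => u _.
rewrite sumr_const !inE -[#|_|]cardsE -/(outdeg D u) -[LHS]mulr_natl.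
by case: eqVneq => [-> | h]; rewrite ?mul0r // divff ?pnatr_eq0.
Qed.

Lemma sum_inv_indeg (D : strict_digraph V) :
  \sum_(e : V * V | D e.1 e.2) (indeg D e.2)%:R^-1
    = #|V|%:R - #|[set u | indeg D u == 0%N]|%:R :> R.
Proof.
rewrite -(sum_inv_outdeg (converse D)).
rewrite (reindex (fun e : V * V => (e.2, e.1))) //=.
by exists (fun e : V * V => (e.2, e.1)) => -[].
Qed.

(** This explains the shape of [L_]: its total over the arcs depends on [D] only through [n0] and
    the order. *)
Lemma sum_L (phi : nat -> nat -> R) (D : strict_digraph V) :
  \sum_(e : V * V | D e.1 e.2) L_ phi #|V| (outdeg D e.1) (indeg D e.2)
    = #|V|.-1%:R / #|V|%:R * (2 * #|V|%:R - (n0 D)%:R) * phi 1%N #|V|.-1.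
Proof.
rewrite /L_ -mulr_suml -mulr_sumr big_split /= sum_inv_outdeg sum_inv_indeg.
by rewrite /n0 natrD; ring.
Qed.

Variables (phi : nat -> nat -> R) (D : strict_digraph V).
Hypothesis (hn : (1 < #|V|)%N).
Hypothesis (phi_sym : forall i j : nat,
  (1 <= i <= #|V|.-1)%N -> (1 <= j <= #|V|.-1)%N -> phi i j = phi j i).

Lemma L_sym n i j : L_ phi n i j = L_ phi n j i.
Proof. by rewrite /L_ [i%:R^-1 + _]addrC. Qed.

Lemma L_extremal : L_ phi #|V| 1 #|V|.-1 = phi 1%N #|V|.-1.
Proof.
(* Writing the denominator [n] as [(n-1) + 1] leaves [field] a single unknown in
   [(n-1)/n * (1 + 1/(n-1)) = 1]. *)
rewrite /L_ -[in X in _ / X](prednK (ltnW hn)).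
have h : (#|V|.-1%:R : R) != 0 by rewrite pnatr_eq0; lia.
have h' : (#|V|.-1.+1%:R : R) != 0 by rewrite pnatr_eq0.
by move: h h'; rewrite -natr1 => h h'; field; rewrite h h'.
Qed.

Lemma phi_extremal_arc u v : extremal_arc D u v ->
  phi (outdeg D u) (indeg D v) = L_ phi #|V| (outdeg D u) (indeg D v).
Proof.
case/orP=> /andP[/eqP-> /eqP->]; first by rewrite L_extremal.
by rewrite L_sym L_extremal phi_sym //; lia.
Qed.

Lemma phi_sym_arc u v : D u v ->
  phi (outdeg D u) (indeg D v) = phi (indeg D v) (outdeg D u).
Proof.
move=> Duv; rewrite phi_sym ?(outdeg_gt0 Duv) ?(indeg_gt0 Duv) //=.
  exact: outdeg_le.
exact: indeg_le.
Qed.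

(** The comparison is termwise: equality on extremal arcs, strict elsewhere, where the degree pair
    or its swap lies in [S1] and both functions are symmetric. *)
Lemma leif_L_phi :
  (forall i j, S1 #|V| i j -> L_ phi #|V| i j < phi i j) ->
  \sum_(e : V * V | D e.1 e.2) L_ phi #|V| (outdeg D e.1) (indeg D e.2)
    <= \sum_(e : V * V | D e.1 e.2) phi (outdeg D e.1) (indeg D e.2)
    ?= iff extremal D.
Proof.
move=> h; apply: leif_sum => -[u v] /= Duv; apply/leifP.
case: ifPn => [hE | /(S1_deg Duv) /orP[] /h //]; first by rewrite phi_extremal_arc.
by rewrite L_sym phi_sym_arc.
Qed.

Lemma leif_phi_L :
  (forall i j, S1 #|V| i j -> phi i j < L_ phi #|V| i j) ->
  \sum_(e : V * V | D e.1 e.2) phi (outdeg D e.1) (indeg D e.2)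
    <= \sum_(e : V * V | D e.1 e.2) L_ phi #|V| (outdeg D e.1) (indeg D e.2)
    ?= iff extremal D.
Proof.
move=> h; apply: leif_sum => -[u v] /= Duv; apply/leifP.
case: ifPn => [hE | /(S1_deg Duv) /orP[] /h //]; first by rewrite phi_extremal_arc.
by rewrite L_sym phi_sym_arc.
Qed.

(** * The two bounds on the index with their equality cases *)

Hypothesis (hD : forall u, ~~ isolated D u).
Hypothesis (phi_pos : 0 < phi 1%N #|V|.-1).

(** In this unit the half-sum of [L_] is [c * (2n - n0)] and the two target bounds are [c * n] and
    [c * 2n]. Positivity of [phi 1 (n-1)] makes [c] cancellable in inequalities. *)
Let c : R := 2^-1 * (#|V|.-1%:R / #|V|%:R * phi 1%N #|V|.-1).

Let c_gt0 : 0 < c.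
Proof. by rewrite !mulr_gt0 ?invr_gt0 ?ltr0n //; lia. Qed.

Let half_sum_L :
  2^-1 * \sum_(e : V * V | D e.1 e.2) L_ phi #|V| (outdeg D e.1) (indeg D e.2)
    = c * (2 * #|V|%:R - (n0 D)%:R).
Proof. by rewrite sum_L /c; ring. Qed.

Lemma leif_index_I_min :
  (forall i j, S1 #|V| i j -> L_ phi #|V| i j < phi i j) ->
  #|V|.-1%:R / 2 * phi 1%N #|V|.-1 <= index_I phi D
    ?= iff (n0 D == #|V|) && extremal D.
Proof.
move=> h; have V0 : #|V|%:R != 0 :> R by rewrite pnatr_eq0; lia.
have -> : #|V|.-1%:R / 2 * phi 1%N #|V|.-1 = c * #|V|%:R.
  by rewrite /c; field.
(* The lower link [c * n <= c * (2n - n0)] is [n0 <= n], tight when [n0 = n]; the upper link is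
   tight when [D] is extremal. [leif_trans] conjoins the two conditions. *)
apply: (leif_trans (x2 := c * (2 * #|V|%:R - (n0 D)%:R))); last first.
  rewrite -half_sum_L; have [hle heq] := leif_L_phi h.
  split; rewrite ?ler_pM2l ?invr_gt0 // -heq (inj_eq (mulfI _)) //.
  by rewrite invr_eq0 pnatr_eq0.
split.
  by rewrite ler_pM2l //; have := n0_le hD; rewrite -(ler_nat R); lra.
rewrite (inj_eq (mulfI (lt0r_neq0 c_gt0))) -(eqr_nat R).
by apply/eqP/eqP => ?; lra.
Qed.

Lemma leif_index_I_max :
  (forall i j, S1 #|V| i j -> phi i j < L_ phi #|V| i j) ->
  index_I phi D <= #|V|.-1%:R * phi 1%N #|V|.-1
    ?= iff extremal D && (n0 D == 0%N).
Proof.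
move=> h; have V0 : #|V|%:R != 0 :> R by rewrite pnatr_eq0; lia.
have -> : #|V|.-1%:R * phi 1%N #|V|.-1 = c * (2 * #|V|%:R).
  by rewrite /c; field.
(* Here the same middle value lies above the index, and [n0 >= 0] gives the last link, tight when
   [n0 = 0]. *)
apply: (leif_trans (x2 := c * (2 * #|V|%:R - (n0 D)%:R))).
  rewrite -half_sum_L; have [hle heq] := leif_phi_L h.
  split; rewrite ?ler_pM2l ?invr_gt0 // -heq (inj_eq (mulfI _)) //.
  by rewrite invr_eq0 pnatr_eq0.
split; first by rewrite ler_pM2l // gerBl.
rewrite (inj_eq (mulfI (lt0r_neq0 c_gt0))) -(eqr_nat R).
by apply/eqP/eqP => ?; lra.
Qed.

End Sums.

Theorem theorem1 (R : realFieldType) (n : nat) (V : finType)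
    (D : strict_digraph V) (phi : nat -> nat -> R)
    (hn : (2 <= n)%N) (hV : #|V| = n)
    (hD : forall u : V, ~~ isolated D u)
    (phi_sym : forall i j : nat, (1 <= i <= n.-1)%N -> (1 <= j <= n.-1)%N ->
       phi i j = phi j i)
    (phi_pos : 0 < phi 1%N n.-1) :
  ((forall i j : nat, S1 n i j -> L_ phi n i j < phi i j) ->
     [/\ (n.-1)%:R / 2 * phi 1%N n.-1 <= index_I phi D,
         index_I phi D = (n.-1)%:R / 2 * phi 1%N n.-1 <->
           (n0 D = n /\ forall i j : nat, S1 n i j -> p_ D i j = 0%N)
       & index_I phi D = (n.-1)%:R / 2 * phi 1%N n.-1 <->
           (is_out_star D \/ is_in_star D)])
  /\
  ((forall i j : nat, S1 n i j -> phi i j < L_ phi n i j) ->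
     [/\ index_I phi D <= (n.-1)%:R * phi 1%N n.-1,
         index_I phi D = (n.-1)%:R * phi 1%N n.-1 <->
           (n0 D = 0%N /\ forall i j : nat, S1 n i j -> p_ D i j = 0%N)
       & index_I phi D = (n.-1)%:R * phi 1%N n.-1 <->
           ((forall u : V, (0 < outdeg D u)%N /\ (0 < indeg D u)%N) /\
            forall u v : V, D u v ->
              (outdeg D u = 1%N /\ indeg D v = n.-1) \/
              (outdeg D u = n.-1 /\ indeg D v = 1%N))]).
Proof.
subst n; split=> h.
  have [hle heq] := leif_index_I_min hn phi_sym hD phi_pos h.
  (* The boolean equality case becomes a proposition, the common pivot for both stated
     characterisations. *)
  have hiff : index_I phi D = #|V|.-1%:R / 2 * phi 1%N #|V|.-1 <->
      n0 D = #|V| /\ extremal D.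
    split=> [e | [e1 e2]].
      by move: heq; rewrite e eqxx => /esym/andP[/eqP].
    by apply/esym/eqP; rewrite heq e1 eqxx.
  by split; rewrite // hiff ?p_eq0_extremal // extremal_starP.
have [hle heq] := leif_index_I_max D hn phi_sym phi_pos h.
have hiff : index_I phi D = #|V|.-1%:R * phi 1%N #|V|.-1 <->
    n0 D = 0%N /\ extremal D.
  split=> [e | [e1 e2]].
    by move: heq; rewrite e eqxx => /esym/andP[? /eqP].
  by apply/eqP; rewrite heq e1 eqxx andbT.
split; rewrite // hiff ?p_eq0_extremal // n0_eq0.
split=> -[h0 hE]; split=> //.
  by move/extremalP: hE => hE u v /hE /orP[] /andP[/eqP-> /eqP->]; [left | right].
by apply/extremalP => u v /hE [] [e1 e2]; rewrite /extremal_arc e1 e2 !eqxx ?orbT.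
Qed.
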